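(* Let $N\ge 1$ be an integer, let $f:[0,\infty)\to\mathbb{R}$ be continuously differentiable, and let $\mathcal{A}(t)=A^{[0]}+f(t)A^{[1]}$ with the $(N+1)\times(N+1)$ matrices $A^{[0]},A^{[1]}$ given in the context. Let $\Omega(t)=\sum_{m=0}^\infty\sum_{\tau\in\mathbb{T}_m}\alpha(\tau)\int_0^t G_\tau(x)\,dx$ be the Magnus expansion of $p'=\mathcal{A}(t)p$ (defined in the context), considered for $t>0$ for which the series over $m$ converges. Then $\Omega(t)=tA^{[0]}+\sigma(t)A^{[1]}$ with $$\sigma(t)=tf(t)+\frac{t(1-e^{-2t})}{1-2t-e^{-2t}}\int_0^t x f'(x)\,\Theta(t,x)\,dx,$$ where, for $0<x\le t$, $$\Theta(t,x)=-\exp\!\left(-4\int_x^t\frac{1-y-(1+y)e^{-2y}}{(1-e^{-2y})(1-2y-e^{-2y})}\,dy\right)\frac{1-2x-e^{-2x}}{x(1-e^{-2x})}.$$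
   Context: Matrices are indexed by $k,\ell\in\{0,\ldots,N\}$. The only possibly nonzero entries of $A^{[0]}$ are $A^{[0]}_{\ell,\ell}=-N$, $A^{[0]}_{\ell-1,\ell}=\ell$, $A^{[0]}_{\ell+1,\ell}=N-\ell$; the only possibly nonzero entries of $A^{[1]}$ are $A^{[1]}_{\ell,\ell}=N-2\ell$, $A^{[1]}_{\ell-1,\ell}=\ell$, $A^{[1]}_{\ell+1,\ell}=-N+\ell$. The commutator is $[A,B]=AB-BA$. Magnus trees: $\mathbb{T}_0=\{\bullet\}$, and for $m\ge1$, $\mathbb{T}_m$ is the (finite) set of ordered pairs $\tau=(\tau_1,\tau_2)$ with $\tau_1\in\mathbb{T}_{m_1}$, $\tau_2\in\mathbb{T}_{m_2}$, $m_1+m_2=m-1$. Matrix-valued functions: $G_\bullet(t)=\mathcal{A}(t)$ and $G_{(\tau_1,\tau_2)}(t)=\left[\int_0^tG_{\tau_1}(x)\,dx,\;G_{\tau_2}(t)\right]$. Coefficients: $\alpha(\bullet)=1$; every $\tau\in\mathbb{T}_m$ with $m\ge1$ can be written uniquely as $\tau=(\eta_1,(\eta_2,(\cdots(\eta_s,\bullet)\cdots)))$ with $s\ge1$ and Magnus trees $\eta_1,\ldots,\eta_s$, and then $\alpha(\tau)=\frac{B_s}{s!}\prod_{j=1}^s\alpha(\eta_j)$, where $B_s$ are the Bernoulli numbers with $B_1=-\tfrac12$. The Magnus expansion is $\Omega(t)=\sum_{m=0}^\infty\sum_{\tau\in\mathbb{T}_m}\alpha(\tau)\int_0^tG_\tau(x)\,dx$;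 the series is understood for those $t$ for which it converges (in particular for small $t$). *)

(* Defs.v *)
From HB Require Import structures.
From mathcomp Require Import all_boot all_order all_algebra.
From mathcomp Require Import all_classical all_reals all_analysis.

Set Implicit Arguments.
Unset Strict Implicit.
Unset Printing Implicit Defensive.

Import Order.TTheory GRing.Theory Num.Theory.
Import numFieldNormedType.Exports.

Local Open Scope classical_set_scope.
Local Open Scope ring_scope.

Definition A0 (R : realType) (N : nat) : 'M[R]_N.+1 :=
  \matrix_(k, l)
    if k == l then - N%:R
    else if k.+1 == l :> nat then l%:R
    else if k == l.+1 :> nat then N%:R - l%:R
    else 0.

Definition A1 (R : realType) (N : nat) : 'M[R]_N.+1 :=
  \matrix_(k, l)
    if k == l then N%:R - 2 * l%:R
    else if k.+1 == l :> nat then l%:R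
    else if k == l.+1 :> nat then - N%:R + l%:R
    else 0.

Definition generator (R : realType) (N : nat) (f : R -> R) (t : R) :
  'M[R]_N.+1 := A0 R N + f t *: A1 R N.

(** A function on [0, +oo[ is represented by a total function of which only the
    values on [0, +oo[ matter: at 0 both the derivative and the continuity are
    one-sided. *)
Definition C1_halfline (R : realType) (f df : R -> R) : Prop :=
  (forall x : R, 0 <= x ->
     (f y - f x) / (y - x) @[y --> within `[0, +oo[ x^'] --> df x) /\
  {within `[0, +oo[, continuous df}.

Inductive magnus_tree : Type :=
| Leaf : magnus_tree
| Node : magnus_tree -> magnus_tree -> magnus_tree.

HB.instance Definition _ := gen_eqMixin magnus_tree.
HB.instance Definition _ := gen_choiceMixin magnus_tree.

Fixpoint tree_order (tau : magnus_tree) : nat :=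
  match tau with
  | Leaf => 0
  | Node tau1 tau2 => (tree_order tau1 + tree_order tau2).+1
  end.

Definition magnus_trees (m : nat) : set magnus_tree :=
  [set tau | tree_order tau = m].

(** The sums [\sum_(tau \in magnus_trees m) _] below are finitely supported
    sums, which would be 0 on an infinite support; hence the relevance of the
    following fact. *)
Lemma finite_magnus_trees (m : nat) : finite_set (magnus_trees m).
Proof.
suff H : finite_set [set tau | (tree_order tau <= m)%N].
  by apply: sub_finite_set H => tau /= ->.
elim: m => [|m IHm].
  apply: (@sub_finite_set _ _ [set Leaf]); last exact: finite_set1.
  by case.
apply: (@sub_finite_set _ _ ([set Leaf] `|`
    [set Node a b | a in [set tau | (tree_order tau <= m)%N]
                  & b in [set tau | (tree_order tau <= m)%N]])).
  case=> [|a b] /=; first by left.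
  rewrite ltnS => ab_m; right; exists a; last exists b => //=.
    by apply: leq_trans ab_m; rewrite leq_addr.
  by apply: leq_trans ab_m; rewrite leq_addl.
by rewrite finite_setU; split; [exact: finite_set1|exact: finite_image2].
Qed.

(** [:: eta_1; ...; eta_s] for (eta_1, (eta_2, ( ... (eta_s, Leaf) ... ))) *)
Fixpoint tree_spine (tau : magnus_tree) : seq magnus_tree :=
  match tau with
  | Leaf => [::]
  | Node eta tau' => eta :: tree_spine tau'
  end.

(** [:: B_0; ...; B_(n-1)], by the recurrence of [bernoulliE] *)
Fixpoint bernoulli_seq (R : realType) (n : nat) : seq R :=
  match n with
  | 0 => [::]
  | n'.+1 =>
    let s := bernoulli_seq R n' in
    rcons s (((n' == 0)%:R - \sum_(k < n') 'C(n'.+1, k)%:R * s`_k) / n'.+1%:R)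
  end.

Definition bernoulli (R : realType) (n : nat) : R := (bernoulli_seq R n.+1)`_n.

Lemma size_bernoulli_seq (R : realType) (n : nat) :
  size (bernoulli_seq R n) = n.
Proof. by elim: n => //= n IHn; rewrite size_rcons IHn. Qed.

Lemma nth_bernoulli_seq (R : realType) (n k : nat) : (k < n)%N ->
  (bernoulli_seq R n)`_k = bernoulli R k.
Proof.
elim: n => // n IHn; rewrite ltnS leq_eqVlt => /predU1P[-> //|kn] /=.
by rewrite nth_rcons size_bernoulli_seq kn IHn.
Qed.

Lemma bernoulliE (R : realType) (n : nat) :
  \sum_(k < n.+1) 'C(n.+1, k)%:R * bernoulli R k = (n == 0)%:R.
Proof.
rewrite big_ord_recr /= {2}/bernoulli /= nth_rcons size_bernoulli_seq ltnn eqxx.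
rewrite binSn mulrCA divff ?pnatr_eq0// mulr1.
under [in X in _ + (_ - X)]eq_bigr do rewrite nth_bernoulli_seq//.
by rewrite addrC subrK.
Qed.

Lemma bernoulli1 (R : realType) : bernoulli R 1 = - 2^-1.
Proof.
have := bernoulliE R 1.
rewrite 2!big_ord_recl big_ord0 /= addr0 bin0 bin1 mul1r.
rewrite {1}/bernoulli /= big_ord0 subr0 divr1 => /eqP.
rewrite addrC addr_eq0 => /eqP h.
by apply: (mulfI (_ : (2 : R) != 0)); rewrite ?pnatr_eq0// h mulrN divff ?pnatr_eq0.
Qed.

(** The inner fixpoint is the product over the spine; see [magnus_coefE]. *)
Fixpoint magnus_coef (R : realType) (tau : magnus_tree) : R :=
  bernoulli R (size (tree_spine tau)) / (size (tree_spine tau))`!%:R *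
  (fix spine_prod (u : magnus_tree) : R :=
     match u with
     | Leaf => 1
     | Node eta u' => magnus_coef R eta * spine_prod u'
     end) tau.

Lemma magnus_coefE (R : realType) (tau : magnus_tree) :
  magnus_coef R tau =
  bernoulli R (size (tree_spine tau)) / (size (tree_spine tau))`!%:R *
  \prod_(eta <- tree_spine tau) magnus_coef R eta.
Proof.
have H u : \prod_(eta <- tree_spine u) magnus_coef R eta =
    (fix spine_prod (u : magnus_tree) : R :=
     match u with
     | Leaf => 1
     | Node eta u' => magnus_coef R eta * spine_prod u'
     end) u.
  by elim: u => [|a _ b IHb]; rewrite ?big_nil// big_cons IHb.
by rewrite H; case: tau.
Qed.

Lemma magnus_coef_Leaf (R : realType) : magnus_coef R Leaf = 1.
Proof.
by rewrite magnus_coefE /= big_nil mulr1 /bernoulli /= big_ord0 subr0 fact0 !divr1.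
Qed.

Definition mx_commutator (R : realType) (n : nat) (A B : 'M[R]_n) : 'M[R]_n :=
  A *m B - B *m A.

Definition mx_integral (R : realType) (n : nat) (F : R -> 'M[R]_n) (t : R) :
  'M[R]_n :=
  \matrix_(i, j) \int[lebesgue_measure]_(x in `[0, t]) (F x i j).

Fixpoint magnus_G (R : realType) (n : nat) (A : R -> 'M[R]_n)
    (tau : magnus_tree) (t : R) : 'M[R]_n :=
  match tau with
  | Leaf => A t
  | Node tau1 tau2 =>
      mx_commutator (mx_integral (magnus_G A tau1) t) (magnus_G A tau2 t)
  end.

Definition magnus_term (R : realType) (n : nat) (A : R -> 'M[R]_n) (t : R)
    (m : nat) : 'M[R]_n :=
  \sum_(tau \in magnus_trees m)
    magnus_coef R tau *: mx_integral (magnus_G A tau) t.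

Definition magnus_converges (R : realType) (n : nat) (A : R -> 'M[R]_n)
    (t : R) : Prop :=
  cvgn (series (magnus_term A t)).

Definition magnus_expansion (R : realType) (n : nat) (A : R -> 'M[R]_n)
    (t : R) : 'M[R]_n :=
  limn (series (magnus_term A t)).

(** Only 0 < x <= t is meaningful; the value at x = 0 (a null set in the
    integral over [0, t] below) is an artefact of division by 0. *)
Definition Theta (R : realType) (t x : R) : R :=
  - expR (- 4 * \int[lebesgue_measure]_(y in `[x, t])
       ((1 - y - (1 + y) * expR (- 2 * y)) /
        ((1 - expR (- 2 * y)) * (1 - 2 * y - expR (- 2 * y))))) *
  ((1 - 2 * x - expR (- 2 * x)) / (x * (1 - expR (- 2 * x)))).

Definition sigma (R : realType) (f df : R -> R) (t : R) : R :=
  t * f t +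
  t * (1 - expR (- 2 * t)) / (1 - 2 * t - expR (- 2 * t)) *
  \int[lebesgue_measure]_(x in `[0, t]) (x * df x * Theta t x).

(* Main.v *)
Require Import Defs.
From mathcomp Require Import all_boot all_order all_algebra.
From mathcomp Require Import all_classical all_reals all_analysis.
From mathcomp Require Import ring zify.

Import Order.TTheory GRing.Theory Num.Theory.
Import numFieldNormedType.Exports.

Local Open Scope classical_set_scope.
Local Open Scope ring_scope.

(** Since [A0, A1] = -2 A1, every Magnus tree other than the leaf contributes a
    multiple of A1, so that Omega(t) = t A0 + sigma(t) A1 where sigma is the sum of
    the scalar terms sigma_m(t) of tree order m. Summing over the trees of order m,
    of which only those with a leaf child at each spine node survive, gives the
    order-m part of
      t sigma' = T(t) t f + (1 - T(t)) sigma,  T(t) = 2 t / (1 - exp (-2 t)).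
    This equation has the integrating factor E(t) = (exp (2 t) - 1) / (2 t):
    graded by order, the Cauchy product of the coefficients of E with (sigma_m(t))
    is the sequence of the int_0^t (2 x)^m / m! f(x) dx. When the Magnus series
    converges at t, however large t is, Mertens' theorem therefore gives
      E(t) sigma(t) = int_0^t exp (2 x) f(x) dx.
    An integration by parts and an explicit primitive of the integrand in Theta
    identify this value of sigma(t) with the stated one. *)

(** * The commutator of [A0] and [A1] *)

Lemma sum_ord_delta (R : pzSemiRingType) (n k : nat) (phi : nat -> R) :
  \sum_(l < n) (k == l :> nat)%:R * phi l = (k < n)%:R * phi k.
Proof.
have [kn|nk] := ltnP k n.
  rewrite (bigD1 (Ordinal kn)) //= eqxx big1 ?addr0// => l /negP lk.
  by case: eqP => [e|_]; rewrite ?mul0r//; case: lk; apply/eqP/val_inj.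
rewrite big1 ?mul0r// => l _; case: eqP => [e|_]; rewrite ?mul0r//.
by have := ltn_ord l; rewrite -e ltnNge nk.
Qed.

(** One row of a tridiagonal matrix applied to [phi]. With [phi n = 0] the superdiagonal term can be
    written unconditionally: in the last row it points outside the matrix. *)
Lemma sum_tridiag (R : comPzRingType) (n i : nat) (p q r phi : nat -> R) :
  (i < n)%N -> phi n = 0 ->
  \sum_(l < n) ((i == l :> nat)%:R * p l + (i.+1 == l :> nat)%:R * q l +
    (i == l.+1 :> nat)%:R * r l) * phi l =
  p i * phi i + q i.+1 * phi i.+1 + (0 < i)%:R * (r i.-1 * phi i.-1).
Proof.
move=> i_n phin.
under eq_bigr do rewrite !mulrDl -!mulrA.
rewrite !big_split /= (sum_ord_delta R n i (fun l => p l * phi l)).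
rewrite (sum_ord_delta R n i.+1 (fun l => q l * phi l)) i_n mul1r.
congr (_ + _ + _).
  by case: (ltngtP i.+1 n) i_n => [|//|->]; rewrite ?mul1r// phin !mulr0.
case: i i_n => [|i] i_n /=.
  by rewrite mul0r big1// => l _; rewrite mul0r.
under eq_bigr do rewrite eqSS.
by rewrite (sum_ord_delta R n i (fun l => r l * phi l)) (ltnW i_n).
Qed.

Lemma A0E (R : realType) (N : nat) (i l : 'I_N.+1) : A0 R N i l =
  (i == l :> nat)%:R * - N%:R + (i.+1 == l :> nat)%:R * l%:R +
  (i == l.+1 :> nat)%:R * (N%:R - l%:R).
Proof.
rewrite mxE -val_eqE /=.
by repeat case: eqP => ?; rewrite ?mul0r ?mul1r ?add0r ?addr0//; lia.
Qed.

Lemma A1E (R : realType) (N : nat) (i l : 'I_N.+1) : A1 R N i l =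
  (i == l :> nat)%:R * (N%:R - 2 * l%:R) + (i.+1 == l :> nat)%:R * l%:R +
  (i == l.+1 :> nat)%:R * (- N%:R + l%:R).
Proof.
rewrite mxE -val_eqE /=.
by repeat case: eqP => ?; rewrite ?mul0r ?mul1r ?add0r ?addr0//; lia.
Qed.

Lemma commutator_A0A1 (R : realType) (N : nat) :
  mx_commutator (A0 R N) (A1 R N) = - 2 *: A1 R N.
Proof.
rewrite /mx_commutator; apply/matrixP => i j.
rewrite [LHS]mxE [X in _ + X]mxE [X in X - _]mxE [X in _ - X]mxE [RHS]mxE.
under eq_bigr do rewrite A0E (A1E _ _ _ j).
under [X in _ - X]eq_bigr do rewrite A1E (A0E _ _ _ j).
rewrite A1E.
(* Here [phi] is column [j] of [A1] continued to all natural row indices. It vanishes at row [N.+1],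
   because the subdiagonal coefficient [- N + j] is 0 at [j = N]. *)
rewrite (sum_tridiag _ _ _ (fun=> - N%:R) (fun l => l%:R) (fun l => N%:R - l%:R)
  (fun l => (l == j)%:R * (N%:R - 2 * j%:R) + (l.+1 == j)%:R * j%:R +
    (l == j.+1)%:R * (- N%:R + j%:R)))//; last first.
  have := ltn_ord j; repeat case: eqP => ?; rewrite ?mul0r ?mul1r ?add0r//; try lia.
  move=> _; have -> : (j : nat) = N by lia.
  by rewrite addNr.
rewrite (sum_tridiag _ _ _ (fun l => N%:R - 2 * l%:R) (fun l => l%:R)
  (fun l => - N%:R + l%:R)
  (fun l => (l == j)%:R * (- N%:R) + (l.+1 == j)%:R * j%:R +
    (l == j.+1)%:R * (N%:R - j%:R)))//; last first.
  have := ltn_ord j; repeat case: eqP => ?; rewrite ?mul0r ?mul1r ?add0r//; try lia.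
  move=> _; have -> : (j : nat) = N by lia.
  by rewrite subrr.
move: (nat_of_ord i) (nat_of_ord j) => {i j} [|k] l /=.
  repeat (case: eqP => ? /=; try (exfalso; lia)); subst; rewrite -?natr1; ring.
rewrite mul1r.
repeat (case: eqP => ? /=; try (exfalso; lia)); subst; rewrite -?natr1; try ring.
all: have ? : l = k by lia.
all: subst; ring.
Qed.

(** * Integrals from 0 *)

Definition primitive {R : realType} (g : R -> R) (t : R) : R :=
  \int[lebesgue_measure]_(x in `[0, t]) g x.

Section primitive_theory.
Context {R : realType}.
Implicit Types (f g : R -> R) (a b t : R).
Local Notation mu := (@lebesgue_measure R).

Lemma continuous_integrable_itv g a b : continuous g ->
  mu.-integrable `[a, b] (EFin \o g).
Proof.
move=> cg; apply: continuous_compact_integrable; first exact: segment_compact.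
exact: continuous_subspaceT.
Qed.

Lemma eq_primitive f g t : (forall x, 0 <= x -> f x = g x) ->
  primitive f t = primitive g t.
Proof.
move=> fg; apply: eq_Rintegral => x; rewrite inE /= in_itv /= => /andP[x0 _].
exact: fg.
Qed.

Lemma primitive0 g : primitive g 0 = 0.
Proof. by rewrite /primitive set_itv1 Rintegral_set1. Qed.

Lemma primitiveD f g t : continuous f -> continuous g ->
  primitive (fun x => f x + g x) t = primitive f t + primitive g t.
Proof.
by move=> cf cg; rewrite /primitive RintegralD//; exact: continuous_integrable_itv.
Qed.

Lemma primitiveZ (c : R) g t : continuous g ->
  primitive (fun x => c * g x) t = c * primitive g t.
Proof.
by move=> cg; rewrite /primitive RintegralZl//; exact: continuous_integrable_itv.
Qed.

Lemma continuous_sum (I : Type) (r : seq I) (F : I -> R -> R) :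
  (forall i, continuous (F i)) -> continuous (fun x => \sum_(i <- r) F i x).
Proof.
move=> cF; elim: r => [|i r IH].
  under eq_fun do rewrite big_nil; move=> x; exact: cst_continuous.
under eq_fun do rewrite big_cons; move=> x.
by apply: cvgD; [exact: cF|exact: IH].
Qed.

Lemma primitive_sum (I : Type) (r : seq I) (c : I -> R) (F : I -> R -> R) t :
  (forall i, continuous (F i)) ->
  primitive (fun x => \sum_(i <- r) c i * F i x) t =
  \sum_(i <- r) c i * primitive (F i) t.
Proof.
move=> cF.
have cS i : continuous (fun x => c i * F i x).
  by move=> x; apply: cvgM; [exact: cvg_cst|exact: cF].
elim: r => [|i r IH].
  rewrite big_nil; under [X in primitive X]funext do rewrite big_nil.
  by rewrite /primitive Rintegral_cst// mul0r.
have cSr : continuous (fun x => \sum_(j <- r) c j * F j x).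
  by apply: continuous_sum => j; exact: cS.
rewrite big_cons -IH -(primitiveZ _ _ _ (cF i)) -(primitiveD _ _ _ (cS i) cSr).
by under [X in primitive X]funext do rewrite big_cons.
Qed.

Lemma primitive_continuous g : continuous g -> continuous (primitive g).
Proof.
move=> cg t; pose M := `|t| + 1.
(* Cutting [g] off to the left of 0 allows the lower limit [- M], so that [t], whatever its sign, is
   interior to [[- M, M]]. *)
have -> : primitive g =
    (parameterized_integral mu (- M)) ^~ (g \_ `[0, +oo[) .
  apply/funext => s; rewrite /parameterized_integral -Rintegral_mkcondr.
  congr Rintegral; apply/seteqP; split => x /=; rewrite !in_itv /=.
    move=> /andP[x0 ->]; rewrite x0 !andbT; split => //.
    by rewrite (le_trans _ x0)// oppr_le0 /M addr_ge0.
  by move=> [/andP[_ ->]]; rewrite andbT => ->.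
have tM : `|t| < M by rewrite /M ltrDl.
have M0 : 0 <= M by rewrite addr_ge0.
have MM : - M < M by rewrite gtrN// (le_lt_trans _ tM).
have ig : mu.-integrable `[- M, M] (EFin \o (g \_ `[0, +oo[)).
  have := continuous_integrable_itv g (- M) M cg.
  rewrite -restrict_EFin => ig; apply/integrable_restrict => //.
  by apply: integrableS ig => //; exact: measurableI.
have := parameterized_integral_continuous (ltW MM) ig.
move=> /(continuous_within_itvP _ MM)[+ _ _]; apply.
by rewrite in_itv /= -ltr_norml.
Qed.

Lemma is_derive_primitive g t : continuous g -> 0 < t ->
  is_derive t 1 (primitive g : R -> R) (g t).
Proof.
move=> cg t0.
have tt1 : t < t + 1 by rewrite ltrDl.
have [dF F'] := continuous_FTC1_closed tt1
  (continuous_integrable_itv g 0 (t + 1) cg) t0 (cg t).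
by split; [exact: dF|rewrite -derive1E; exact: F'].
Qed.

(** A [primitive] is constantly 0 on the negative axis, so derivatives are available only at
    positive points; continuity of [F] takes care of the endpoints. *)
Lemma primitive_unique (F h : R -> R) t : 0 <= t -> continuous h ->
  continuous F -> F 0 = 0 -> (forall x : R, 0 < x -> is_derive x 1 F (h x)) ->
  primitive h t = F t.
Proof.
rewrite le_eqVlt => /predU1P[<- ? ? ->|t0 ch cF F0 dF]; first by rewrite primitive0.
rewrite /primitive /Rintegral (continuous_FTC2 t0 _ _ _ (F := F)).
- by rewrite F0 -EFinB subr0.
- exact: continuous_subspaceT.
- split.
  + move=> x; rewrite in_itv /= => /andP[x0 _]; exact: (@ex_derive _ _ _ _ _ _ _ (dF x x0)).
  + exact/cvg_at_right_filter/cF.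
  + exact/cvg_at_left_filter/cF.
- move=> x; rewrite in_itv /= => /andP[x0 _].
  by rewrite derive1E (@derive_val _ _ _ _ _ _ _ (dF x x0)).
Qed.

Lemma primitive_cst (c : R) t : 0 <= t -> primitive (fun=> c) t = c * t.
Proof.
move=> t0; apply: (primitive_unique (fun x => c * x)) => //.
- by move=> x; exact: cst_continuous.
- by move=> x; apply: cvgM; [exact: cvg_cst|exact: cvg_id].
- by rewrite mulr0.
- move=> x x0; apply: is_derive_eq; rewrite /GRing.scale/=; ring.
Qed.

End primitive_theory.

(** * Coordinates of the Magnus terms in the span of [A0] and [A1] *)

(** Coefficient of [A1] in [magnus_G]. The coefficient of [A0] is 1 for the leaf and 0 otherwise,
    hence [t] or 0 after integration; the bracket, by [[A0, A1] = - 2 A1], pairs each [A1] part with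
    the other child's [A0] part. *)
Fixpoint A1_coord {R : realType} (f : R -> R) (tau : magnus_tree) (t : R) : R :=
  match tau with
  | Leaf => f t
  | Node a b =>
      2 * ((tree_order b == 0)%:R * primitive (A1_coord f a) t -
           (tree_order a == 0)%:R * t * A1_coord f b t)
  end.

Section coordinates.
Context {R : realType} {N : nat}.
Implicit Types (f g : R -> R) (t : R) (tau : magnus_tree).

Lemma A1_coord_continuous f tau : continuous f -> continuous (A1_coord f tau).
Proof.
move=> cf; elim: tau => [//|a IHa b IHb] t /=.
apply: cvgM; first exact: cvg_cst.
apply: cvgB; apply: cvgM; first exact: cvg_cst.
- exact: primitive_continuous.
- by apply: cvgM; [exact: cvg_cst|exact: cvg_id].
- exact: IHb.
Qed.

Lemma mx_commutator_span (a0 a1 b0 b1 : R) :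
  mx_commutator (a0 *: A0 R N + a1 *: A1 R N) (b0 *: A0 R N + b1 *: A1 R N) =
  (2 * (a1 * b0 - a0 * b1)) *: A1 R N.
Proof.
have := commutator_A0A1 R N; rewrite /mx_commutator => A01.
have -> : (2 * (a1 * b0 - a0 * b1)) *: A1 R N =
    (a0 * b1 - a1 * b0) *: (- 2 *: A1 R N) by rewrite scalerA; congr (_ *: _); ring.
rewrite -A01 !mulmxDl !mulmxDr -!scalemxAl -!scalemxAr !scalerA.
rewrite scalerBr !scalerBl.
rewrite (mulrC b0 a0) (mulrC b0 a1) (mulrC b1 a0) (mulrC b1 a1).
set X := A0 R N *m A0 R N; set Y := A0 R N *m A1 R N.
set Z := A1 R N *m A0 R N; set W := A1 R N *m A1 R N.
apply/matrixP => i j; rewrite !mxE; ring.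
Qed.

Lemma mx_integral_span (F : R -> 'M[R]_N.+1) (c : R) g t : 0 <= t ->
  continuous g ->
  (forall x, 0 <= x -> F x = c *: A0 R N + g x *: A1 R N) ->
  mx_integral F t = (c * t) *: A0 R N + primitive g t *: A1 R N.
Proof.
move=> t0 cg FE; apply/matrixP => i j; rewrite [LHS]mxE.
rewrite -[LHS]/(primitive (fun x => F x i j) t).
rewrite (eq_primitive _ (fun x => c * A0 R N i j + A1 R N i j * g x)); last first.
  by move=> x /FE ->; rewrite [LHS]mxE [X in X + _]mxE [X in _ + X]mxE [X in _ + X]mulrC.
rewrite primitiveD; first last.
- by move=> x; apply: cvgM; [exact: cvg_cst|exact: cg].
- by move=> x; exact: cst_continuous.
rewrite primitive_cst// primitiveZ//.
by rewrite [RHS]mxE [X in _ = X + _]mxE [X in _ = _ + X]mxE mulrAC [X in _ + X]mulrC.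
Qed.

(** Only the values of [f] on the half-line matter; [g] agrees with it there and is continuous on
    the whole line, which makes all iterated integrals continuous without one-sided conditions. *)
Lemma magnus_G_span f g tau t : (forall x, 0 <= x -> f x = g x) ->
  continuous g -> 0 <= t ->
  magnus_G (generator N f) tau t =
  (tree_order tau == 0)%:R *: A0 R N + A1_coord g tau t *: A1 R N.
Proof.
move=> fg cg; elim: tau t => [|a IHa b IHb] t t0 /=.
  by rewrite scale1r /generator fg.
rewrite (mx_integral_span _ _ _ _ t0 (A1_coord_continuous _ a cg) IHa) IHb//.
rewrite mx_commutator_span scale0r add0r; congr (_ *: _).
by rewrite [primitive _ _ * _]mulrC.
Qed.

(** The scalar term sigma_m(t). *)
Definition magnus_coord g (m : nat) t : R :=
  \sum_(tau \in magnus_trees m) magnus_coef R tau * primitive (A1_coord g tau) t.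

Lemma magnus_term_span f g m t : (forall x, 0 <= x -> f x = g x) ->
  continuous g -> 0 <= t ->
  magnus_term (generator N f) t m =
  ((m == 0)%:R * t) *: A0 R N + magnus_coord g m t *: A1 R N.
Proof.
move=> fg cg t0; rewrite /magnus_term /magnus_coord.
have E tau : magnus_coef R tau *: mx_integral (magnus_G (generator N f) tau) t =
    (magnus_coef R tau * ((tree_order tau == 0)%:R * t)) *: A0 R N +
    (magnus_coef R tau * primitive (A1_coord g tau) t) *: A1 R N.
  rewrite (mx_integral_span _ _ _ _ t0 (A1_coord_continuous _ tau cg)
    (fun x => magnus_G_span _ _ _ _ fg cg)).
  by rewrite scalerDr !scalerA.
have fin := finite_magnus_trees m.
rewrite !fsbig_finite//=; under eq_bigr do rewrite E.
rewrite big_split /= -!scaler_suml; congr (_ *: _ + _).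
rewrite -fsbig_finite//.
case: m fin => [|m] fin.
  have -> : magnus_trees 0 = [set Leaf] by apply/seteqP; split => -[].
  by rewrite fsbig_set1 magnus_coef_Leaf mul1r.
by rewrite fsbig1 ?mul0r// => tau /= ->; rewrite mul0r mulr0.
Qed.

End coordinates.

(** * Cauchy products of sequences *)

Section cauchy_product.
Context {R : comNzRingType}.
Implicit Types (a b c : nat -> R) (n : nat).

Definition conv a b n : R := \sum_(i < n.+1) a i * b (n - i)%N.

(** Truncated polynomials carry the Cauchy product up to degree [n], so commutativity and
    associativity of [conv] are inherited from the polynomial ring. *)
Lemma coef_poly_mul a b n k : (k <= n)%N ->
  ((\poly_(i < n.+1) a i) * (\poly_(i < n.+1) b i))`_k = conv a b k.
Proof.
move=> kn; rewrite coefM; apply: eq_bigr => i _; rewrite !coef_poly.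
by rewrite !ltnS (leq_trans (leq_subr _ _) kn) (leq_trans (leq_ord i) kn).
Qed.

Lemma convC a b n : conv a b n = conv b a n.
Proof. by rewrite -!(coef_poly_mul _ _ n)// mulrC. Qed.

Lemma convA a b c n : conv a (conv b c) n = conv (conv a b) c n.
Proof.
have h u v k : (k <= n)%N ->
    (\poly_(i < n.+1) conv u v i)`_k =
    ((\poly_(i < n.+1) u i) * (\poly_(i < n.+1) v i))`_k.
  by move=> kn; rewrite coef_poly ltnS kn coef_poly_mul.
rewrite -!(coef_poly_mul _ _ n)//.
transitivity ((\poly_(i < n.+1) a i * (\poly_(i < n.+1) b i *
   \poly_(i < n.+1) c i))`_n).
  by rewrite [LHS]coefM [RHS]coefM; apply: eq_bigr => i _; rewrite h// leq_subr.
by rewrite mulrA [LHS]coefM [RHS]coefM; apply: eq_bigr => i _; rewrite h// -ltnS.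
Qed.

Lemma eq_convl a a' b n : (forall k, a k = a' k) -> conv a b n = conv a' b n.
Proof. by move=> aa'; apply: eq_bigr => i _; rewrite aa'. Qed.

Lemma eq_convr a b b' n : (forall k, b k = b' k) -> conv a b n = conv a b' n.
Proof. by move=> bb'; apply: eq_bigr => i _; rewrite bb'. Qed.

Lemma conv_delta a n : conv a (fun k => (k == 0)%:R) n = a n.
Proof.
rewrite /conv (bigD1 ord_max)//= subnn eqxx mulr1 big1 ?addr0// => i ni.
rewrite subn_eq0 leqNgt (_ : (i < n)%N) ?mulr0//.
by rewrite ltn_neqAle -ltnS ltn_ord andbT.
Qed.

Lemma conv_scale (x : R) a b n :
  conv (fun k => a k * x ^+ k) (fun k => b k * x ^+ k) n = conv a b n * x ^+ n.
Proof.
rewrite /conv mulr_suml; apply: eq_bigr => i _.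
by rewrite mulrACA -exprD subnKC// -ltnS.
Qed.

Lemma convDl a a' b n :
  conv (fun k => a k + a' k) b n = conv a b n + conv a' b n.
Proof. by rewrite /conv -big_split; apply: eq_bigr => i _; rewrite mulrDl. Qed.

Lemma convDr a b b' n :
  conv a (fun k => b k + b' k) n = conv a b n + conv a b' n.
Proof. by rewrite /conv -big_split; apply: eq_bigr => i _; rewrite mulrDr. Qed.

Lemma convNr a b n : conv a (fun k => - b k) n = - conv a b n.
Proof. by rewrite /conv -sumrN; apply: eq_bigr => i _; rewrite mulrN. Qed.

Lemma convZr (x : R) a b n : conv a (fun k => b k * x) n = conv a b n * x.
Proof. by rewrite /conv mulr_suml; apply: eq_bigr => i _; rewrite mulrA. Qed.

End cauchy_product.

(** * Power series attached to the Bernoulli numbers *)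

Section bernoulli_series.
Context {R : realType}.
Implicit Types n k : nat.

Local Lemma factR_neq0 n : n`!%:R != 0 :> R.
Proof. by rewrite pnatr_eq0 -lt0n fact_gt0. Qed.

Lemma bin_factV n k : (k <= n)%N ->
  'C(n, k)%:R / n`!%:R = (k`!%:R)^-1 * ((n - k)`!%:R)^-1 :> R.
Proof.
move=> kn; rewrite -(bin_fact kn) !natrM.
by field; rewrite !factR_neq0 pnatr_eq0 -lt0n bin_gt0 kn.
Qed.

(** Taylor coefficients at 0 of 2 z / (1 - exp (-2 z)), (exp (2 z) - 1) / (2 z) and
    exp (2 z), respectively *)
Definition todd_coef n : R := bernoulli R n / n`!%:R * (- 2) ^+ n.
Definition divexp_coef n : R := 2 ^+ n / n.+1`!%:R.
Definition exp2_coef n : R := 2 ^+ n / n`!%:R.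

(** The second sequence holds the Taylor coefficients of (1 - exp (-2 z)) / (2 z), the reciprocal of
    T. Divided by (n+1)! and multiplied by (-2)^n, the recurrence [bernoulliE] is this identity. *)
Lemma conv_todd n :
  conv todd_coef (fun k => (- 2) ^+ k / k.+1`!%:R) n = (n == 0)%:R.
Proof.
transitivity ((n == 0)%:R / n.+1`!%:R * (- 2) ^+ n : R); last first.
  by case: n => [|n]; rewrite ?mul0r// expr0 !mulr1 divr1.
rewrite -bernoulliE 2!mulr_suml; apply: eq_bigr => i _.
have i_n : (i <= n)%N by rewrite -ltnS.
rewrite (mulrAC 'C(_, _)%:R) bin_factV 1?ltnW// /todd_coef subSn//.
have -> : (- 2) ^+ n = (- 2) ^+ i * (- 2) ^+ (n - i) :> R.
  by rewrite -exprD subnKC.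
ring.
Qed.

(** Coefficients of exp (2 z) (1 - exp (-2 z)) / (2 z) = (exp (2 z) - 1) / (2 z). *)
Lemma conv_exp2 n :
  conv exp2_coef (fun k => (- 2) ^+ k / k.+1`!%:R) n = divexp_coef n.
Proof.
(* Binomial expansion of (1 - 1)^(n+1), with its first term moved across. *)
have alt : \sum_(i < n.+1) (-1) ^+ i * 'C(n.+1, i.+1)%:R = 1 :> R.
  have := exprDn (1 : R) (-1) n.+1; rewrite subrr expr0n /= big_ord_recl.
  rewrite subn0 expr1n expr0 mulr1 bin0 mulr1n => /esym/eqP.
  rewrite addr_eq0 => /eqP e; rewrite [RHS]e -sumrN; apply: eq_bigr => i _.
  by rewrite lift0 expr1n mul1r exprS -mulr_natr; ring.
transitivity (divexp_coef n * \sum_(i < n.+1) (-1) ^+ i * 'C(n.+1, i.+1)%:R : R);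
  last by rewrite alt mulr1.
rewrite mulr_sumr convC; apply: eq_bigr => i _.
have i_n : (i <= n)%N by rewrite -ltnS.
transitivity (2 ^+ n * ((-1) ^+ i * ('C(n.+1, i.+1)%:R / n.+1`!%:R)) : R);
  last by rewrite /divexp_coef; ring.
rewrite bin_factV// subSS /exp2_coef.
have -> : 2 ^+ n = 2 ^+ i * 2 ^+ (n - i) :> R by rewrite -exprD subnKC.
have -> : (- 2) ^+ i = (-1) ^+ i * 2 ^+ i :> R by rewrite -exprMn mulN1r.
ring.
Qed.

(** E T = exp (2 z): by [conv_exp2], E is exp (2 z) times the reciprocal of T. *)
Lemma conv_divexp_todd n : conv divexp_coef todd_coef n = exp2_coef n.
Proof.
rewrite -(eq_convl _ _ _ _ conv_exp2) -convA.
under eq_convr do rewrite convC conv_todd.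
exact: conv_delta.
Qed.

(** Coefficients of (z E)' = exp (2 z). *)
Lemma divexp_coefS n : n.+1%:R * divexp_coef n = exp2_coef n.
Proof.
rewrite /divexp_coef /exp2_coef factS natrM invfM mulrCA.
by rewrite mulVKf// pnatr_eq0.
Qed.

Lemma todd_coef0 : todd_coef 0 = 1.
Proof.
rewrite /todd_coef expr0 mulr1; have := magnus_coef_Leaf R.
by rewrite magnus_coefE /= big_nil mulr1.
Qed.

End bernoulli_series.

(** * Recursion along the spine of a tree *)

Section spine_recursion.
Context {R : realType}.
Implicit Types (g : R -> R) (t : R) (tau : magnus_tree) (m k : nat).

(** A shifted magnus_coef, which lets the recursion along the spine close. *)
Definition spine_weight k tau : R :=
  bernoulli R (k + size (tree_spine tau)) / (k + size (tree_spine tau))`!%:R *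
  \prod_(eta <- tree_spine tau) magnus_coef R eta.

Lemma spine_weight0 tau : spine_weight 0 tau = magnus_coef R tau.
Proof. by rewrite [RHS]magnus_coefE. Qed.

Lemma spine_weight_Node_Leaf k a :
  spine_weight k (Node a Leaf) =
  bernoulli R k.+1 / k.+1`!%:R * magnus_coef R a.
Proof. by rewrite /spine_weight /= big_seq1 addn1. Qed.

Lemma spine_weight_Leaf_Node k b :
  spine_weight k (Node Leaf b) = spine_weight k.+1 b.
Proof. by rewrite /spine_weight /= big_cons magnus_coef_Leaf mul1r addnS. Qed.

Lemma fsbig_Node_Leaf m (F : magnus_tree -> R) :
  (forall a b, tree_order b != 0 -> F (Node a b) = 0) ->
  \sum_(tau \in magnus_trees m.+1) F tau =
  \sum_(a \in magnus_trees m) F (Node a Leaf).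
Proof.
move=> F0; rewrite -(fsbig_image _ (fun a => Node a Leaf)); last first.
  by move=> a b _ _ [].
apply/esym/fsbig_widen.
  by move=> _ [a <- <-]; rewrite /magnus_trees /= addn0.
move=> [[]//|a b] [/= [ab] nab]; rewrite /preimage /=; apply: F0; apply/negP => b0.
case: b b0 ab nab => //= _; rewrite addn0 => am; apply; by exists a.
Qed.

Lemma fsbig_Leaf_Node m (F : magnus_tree -> R) :
  (forall a b, tree_order a != 0 -> F (Node a b) = 0) ->
  \sum_(tau \in magnus_trees m.+1) F tau =
  \sum_(b \in magnus_trees m) F (Node Leaf b).
Proof.
move=> F0; rewrite -(fsbig_image _ (fun b => Node Leaf b)); last first.
  by move=> a b _ _ [].
apply/esym/fsbig_widen; first by move=> _ [a <- <-].
move=> [[]//|a b] [/= [ab] nab]; rewrite /preimage /=; apply: F0; apply/negP => a0.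
case: a a0 ab nab => //= _; rewrite add0n => am; apply; by exists b.
Qed.

(** At [k = 0] this is the derivative of sigma_m; a larger [k] counts leaves already stripped off
    the top of the spine. *)
Definition spine_sum g m k t : R :=
  \sum_(tau \in magnus_trees m) spine_weight k tau * A1_coord g tau t.

Lemma spine_sum0 g k t :
  spine_sum g 0 k t = bernoulli R k / k`!%:R * g t.
Proof.
rewrite /spine_sum.
have -> : magnus_trees 0 = [set Leaf] by apply/seteqP; split => -[].
by rewrite fsbig_set1 /spine_weight /= big_nil mulr1 addn0.
Qed.

(** Only trees with a leaf child contribute, as the bracket of two multiples of
    A1 vanishes. *)
Lemma spine_sumS g m k t : spine_sum g m.+1 k t =
  - 2 * t * spine_sum g m k.+1 t +
  2 * (bernoulli R k.+1 / k.+1`!%:R) * magnus_coord g m t.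
Proof.
pose Fr tau := if tau is Node a b then
  spine_weight k tau * (2 * ((tree_order b == 0)%:R * primitive (A1_coord g a) t))
  else 0.
pose Fl tau := if tau is Node a b then
  spine_weight k tau * (- 2 * ((tree_order a == 0)%:R * t * A1_coord g b t))
  else 0.
have fin := finite_magnus_trees.
transitivity (\sum_(tau \in magnus_trees m.+1) (Fl tau + Fr tau)).
  rewrite /spine_sum; apply: eq_fsbigr => -[|a b]; rewrite inE // => _ /=; ring.
rewrite fsbig_split//= fsbig_Leaf_Node; last first.
  by move=> a b /= /negbTE ->; rewrite !mul0r !mulr0.
rewrite fsbig_Node_Leaf; last first.
  by move=> a b /= /negbTE ->; rewrite !mul0r !mulr0.
rewrite /spine_sum /magnus_coord !fsbig_finite// !mulr_sumr.
congr (_ + _); apply: eq_bigr => tau _; rewrite /Fl /Fr.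
  by rewrite spine_weight_Leaf_Node /=; ring.
by rewrite spine_weight_Node_Leaf /=; ring.
Qed.

(** Unrolls [spine_sumS] down to order 0, each step stripping a leaf and raising the Bernoulli
    index. Summand [s] comes from the trees [Node a Leaf] met after [s] leaves have been stripped,
    the first term from the leaf that remains after [m] of them. *)
Lemma spine_sumE g m k t : spine_sum g m k t =
  (- 2 * t) ^+ m * (bernoulli R (m + k) / (m + k)`!%:R) * g t +
  \sum_(s < m) (- 2 * t) ^+ s *
    (2 * (bernoulli R (s.+1 + k) / (s.+1 + k)`!%:R)) * magnus_coord g (m - s.+1) t.
Proof.
elim: m k => [|m IH] k; first by rewrite big_ord0 spine_sum0 addr0 expr0 mul1r.
rewrite spine_sumS IH big_ord_recl expr0 mul1r subn1 mulrDr -addrA.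
rewrite addSnnS exprS !mulrA; congr (_ + _); rewrite addrC; congr (_ + _).
rewrite mulr_sumr; apply: eq_bigr => s _; rewrite lift0 (addSnnS s.+1 k) exprS subSS; ring.
Qed.

Lemma magnus_trees_seq m : exists r : seq magnus_tree, forall F : magnus_tree -> R,
  \sum_(tau \in magnus_trees m) F tau = \sum_(tau <- r) F tau.
Proof.
exists (finmap.enum_fset (fset_set (magnus_trees m))) => F.
by rewrite fsbig_finite//; exact: finite_magnus_trees.
Qed.

Lemma magnus_coordE g m t : continuous g ->
  magnus_coord g m t = primitive (spine_sum g m 0) t.
Proof.
move=> cg.
have cF tau : continuous (A1_coord g tau) by exact: A1_coord_continuous.
have [r rE] := magnus_trees_seq m.
have -> : spine_sum g m 0 = fun x => \sum_(tau <- r)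
    magnus_coef R tau * A1_coord g tau x.
  apply/funext => x; rewrite /spine_sum rE.
  by apply: eq_bigr => tau _; rewrite spine_weight0.
by rewrite /magnus_coord rE primitive_sum.
Qed.

Lemma magnus_coord_continuous g m : continuous g -> continuous (magnus_coord g m).
Proof.
move=> cg; have [r rE] := magnus_trees_seq m.
have -> : magnus_coord g m = fun x => \sum_(tau <- r)
    magnus_coef R tau * primitive (A1_coord g tau) x.
  by apply/funext => x; rewrite /magnus_coord rE.
apply: continuous_sum => tau x; apply: cvgM; first exact: cvg_cst.
exact/primitive_continuous/A1_coord_continuous.
Qed.

Lemma spine_sum_continuous g m k : continuous g -> continuous (spine_sum g m k).
Proof.
move=> cg; have [r rE] := magnus_trees_seq m.
have -> : spine_sum g m k = fun x => \sum_(tau <- r)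
    spine_weight k tau * A1_coord g tau x.
  by apply/funext => x; rewrite /spine_sum rE.
apply: continuous_sum => tau x; apply: cvgM; first exact: cvg_cst.
exact: A1_coord_continuous.
Qed.

Lemma is_derive_magnus_coord g m t : continuous g -> 0 < t ->
  is_derive t 1 (magnus_coord g m) (spine_sum g m 0 t).
Proof.
move=> cg t0; have -> : magnus_coord g m = primitive (spine_sum g m 0).
  by apply/funext => x; rewrite magnus_coordE.
exact/is_derive_primitive/t0/spine_sum_continuous.
Qed.

Lemma magnus_coord0 g m : continuous g -> magnus_coord g m 0 = 0.
Proof. by move=> cg; rewrite magnus_coordE// primitive0. Qed.

(** The equation t sigma' = T (t g) + sigma - T sigma, graded by tree order, where
    T is the generating function of todd_coef evaluated at t. *)
Lemma spine_sum_conv g m t :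
  t * spine_sum g m 0 t =
  todd_coef m * t ^+ m * (t * g t) + magnus_coord g m t -
  conv (fun k => todd_coef k * t ^+ k) (magnus_coord g ^~ t) m.
Proof.
(* As [todd_coef 0] is 1, the index-0 term of the convolution is sigma_m itself and cancels the
   added [magnus_coord g m t]. *)
have cancel (a b c : R) : a + b - (b + c) = a - c by ring.
rewrite spine_sumE addn0 mulrDr /conv big_ord_recl /= subn0 todd_coef0 expr0.
rewrite !mul1r cancel; congr (_ + _); first by rewrite /todd_coef exprMn; ring.
rewrite mulr_sumr -sumrN; apply: eq_bigr => s _.
have -> : bump 0 s = s.+1 by [].
by rewrite addn0 /todd_coef !exprMn !exprS; ring.
Qed.

End spine_recursion.

(** * The integrating factor, graded by order *)

Section generating_identity.
Context {R : realType}.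
Implicit Types (g : R -> R) (t : R) (m : nat).

(** Graded form of (E sigma)' = exp (2 x) g. By [spine_sum_conv], x (E sigma)' = (x E' + E - E T)
    sigma + E T x g, and the bracket vanishes since x E' + E = exp (2 x) = E T. Both sides are 0 at
    [t = 0]. *)
Lemma conv_divexp_magnus g m t : continuous g -> 0 <= t ->
  conv (fun k => divexp_coef k * t ^+ k) (magnus_coord g ^~ t) m =
  primitive (fun x => exp2_coef m * x ^+ m * g x) t.
Proof.
move=> cg t0; apply/esym.
have cX (k : nat) : continuous (fun x : R => x ^+ k).
  by move=> x; exact: exprn_continuous.
apply: (primitive_unique (fun x => conv (fun k => divexp_coef k * x ^+ k)
   (magnus_coord g ^~ x) m)) => //.
- move=> x; apply: cvgM; last exact: cg.
  by apply: cvgM; [exact: cvg_cst|exact: cX].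
- apply: continuous_sum => i x; apply: cvgM; last exact: magnus_coord_continuous.
  by apply: cvgM; [exact: cvg_cst|exact: cX].
- by rewrite /conv big1// => i _; rewrite magnus_coord0// mulr0.
move=> x x0.
pose F (k : 'I_m.+1) (y : R) : R :=
  divexp_coef k * y ^+ k * magnus_coord g (m - k) y.
pose dF (k : 'I_m.+1) : R :=
  divexp_coef k * (k%:R * x ^+ k.-1) * magnus_coord g (m - k) x +
  divexp_coef k * x ^+ k * spine_sum g (m - k) 0 x.
have dFE k : is_derive x 1 (F k) (dF k).
  have ? := is_derive_magnus_coord g (m - k) x cg x0.
  have -> : F k = (divexp_coef k *: (@id R) ^+ k) * magnus_coord g (m - k).
    by apply/funext => y; rewrite /F !fctE.
  apply: is_derive_eq; rewrite /dF !fctE /GRing.scale /=; ring.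
have -> : (fun y => conv (fun k => divexp_coef k * y ^+ k)
   (magnus_coord g ^~ y) m) = \sum_(k < m.+1) F k.
  by apply/funext => y; rewrite fct_sumE.
apply: (is_derive_eq (is_derive_sum dFE)).
(* The factor [x] keeps degrees aligned: x times the derivative of x^k is k x^k, and
   [spine_sum_conv] becomes applicable. *)
apply: (mulfI (lt0r_neq0 x0)).
pose e k := divexp_coef k * x ^+ k; pose s := magnus_coord g ^~ x.
pose b k := todd_coef k * x ^+ k; pose E k := exp2_coef k * x ^+ k.
transitivity (conv (fun k => k%:R * e k) s m +
    conv e (fun k => x * spine_sum g k 0 x) m).
  rewrite /conv -big_split mulr_sumr; apply: eq_bigr => k _.
  rewrite /dF /e /s /=; case: (k : nat) => [|j] /=; rewrite ?exprS; ring.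
rewrite (eq_convr e _ _ m (fun k => spine_sum_conv g k x)).
rewrite convDr convNr convDr (convZr (x * g x)) convA.
have eb k : conv e b k = E k by rewrite /e /b conv_scale conv_divexp_todd.
rewrite eb (eq_convl _ E s m eb).
have -> : conv E s m = conv (fun k => k%:R * e k) s m + conv e s m.
  rewrite -convDl; apply: eq_convl => k.
  by rewrite /E /e -divexp_coefS -natr1; ring.
rewrite /E; ring.
Qed.

End generating_identity.

(** * Convergence of Cauchy products *)

Section mertens.
Context {R : realType}.
Implicit Types (u v : nat -> R) (n : nat).

Lemma series_conv u v n :
  series (conv u v) n = \sum_(k < n) u k * series v (n - k)%N.
Proof.
rewrite seriesEord /=; elim: n => [|n IH]; first by rewrite !big_ord0.
rewrite big_ord_recr /= IH big_ord_recr /= /conv big_ord_recr /= addrA.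
rewrite subSnn subnn -big_split /=; congr (_ + _); last first.
  by rewrite seriesEord /= big_ord1.
apply: eq_bigr => i _; rewrite -mulrDr subSn; last exact/ltnW.
by rewrite [in RHS]seriesSr.
Qed.

(** The sum is split at an index [p] beyond which the tail of [u] is small and [v] is bounded; for
    [k < p] the index [n - k] is at least [K], so [v] is small there. *)
Lemma cvg_conv0 u v : (forall k, 0 <= u k) -> cvgn (series u) ->
  v @ \oo --> 0 -> (fun n => \sum_(k < n) u k * v (n - k)%N) @ \oo --> 0.
Proof.
move=> u0 cu v0.
have [U [U0 uU]] : exists U, 0 < U /\ forall n, series u n <= U.
  exists (limn (series u) + 1); split.
    rewrite ltr_wpDl//; apply: limr_ge => //; apply: nearW => n.
    by rewrite seriesEord sumr_ge0.
  move=> n; rewrite (@le_trans _ _ (limn (series u)))// ?lerDl//.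
  apply: nondecreasing_cvgn_le => //; apply: nondecreasing_series => i _ _; exact: u0.
have [V [V0 vV]] : exists V, 0 < V /\ forall n, `|v n| <= V.
  have /cvg_seq_bounded := cvgP _ v0.
  move=> /ex_strict_bound_gt0 [V V0 vV]; exists V; split => // n.
  by apply/ltW/vV.
apply/cvgrPdist_le => e e0.
(* [U] bounds the partial sums of [u] and [V] bounds [v], so each half of the split sum is at most
   [e / 2]. *)
have eU : 0 < e / 2 / U by rewrite !divr_gt0.
have eV : 0 < e / 2 / V by rewrite !divr_gt0.
have /cvgrPdist_le /(_ _ eU) [K _ vK] := v0.
have /cvgrPdist_le /(_ _ eV) [p _ /(_ p (leqnn p)) /= up] := cu.
exists (p + K)%N => // n /= pKn; rewrite sub0r normrN.
have pn : (p <= n)%N by rewrite (leq_trans _ pKn)// leq_addr.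
rewrite -(big_mkord xpredT (fun k => u k * v (n - k)%N)).
rewrite (big_cat_nat (leq0n p) pn) /= [leRHS](splitr e).
apply: (le_trans (ler_normD _ _)); apply: lerD; apply: (le_trans (ler_norm_sum _ _ _)).
  apply: (@le_trans _ _ (\sum_(0 <= k < p) u k * (e / 2 / U))).
    apply: ler_sum_nat => k /andP[_ kp]; rewrite normrM (ger0_norm (u0 k)).
    apply: ler_wpM2l => //; have := vK (n - k)%N; rewrite /= sub0r normrN; apply.
    by rewrite leq_subRL; lia.
  rewrite -mulr_suml mulrA ler_pdivrMr// mulrC ler_wpM2l ?(uU p)//.
  by rewrite divr_ge0// ltW.
apply: (@le_trans _ _ (\sum_(p <= k < n) u k * V)).
  apply: ler_sum_nat => k _; rewrite normrM (ger0_norm (u0 k)).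
  by apply: ler_wpM2l.
rewrite -mulr_suml -ler_pdivlMr//; apply: le_trans up; apply: le_trans (ler_norm _).
rewrite -sub_series_geq// lerB//; apply: nondecreasing_cvgn_le => //.
by apply: nondecreasing_series => i _ _; exact: u0.
Qed.

(** Mertens' theorem *)
Lemma cvg_series_conv u v : (forall k, 0 <= u k) -> cvgn (series u) ->
  cvgn (series v) ->
  series (conv u v) @ \oo --> limn (series u) * limn (series v).
Proof.
move=> u0 cu cv.
(* Replacing [series v] by its limit in [series_conv] leaves the convolution of [u] with a null
   sequence. *)
have -> : series (conv u v) = fun n => series u n * limn (series v) +
    \sum_(k < n) u k * (series v (n - k)%N - limn (series v)).
  apply/funext => n; rewrite series_conv (seriesEord u) /= mulr_suml -big_split.
  by apply: eq_bigr => k _ /=; rewrite -mulrDr addrC subrK.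
rewrite -[X in _ --> X]addr0; apply: cvgD.
  by apply: cvgM; [exact: cu|exact: cvg_cst].
apply: (cvg_conv0 u (fun n => series v n - limn (series v))) => //.
by rewrite -(subrr (limn (series v))); apply: cvgB; [exact: cv|exact: cvg_cst].
Qed.

End mertens.

(** * Summation over the orders *)

Section exponential_weight.
Context {R : realType}.
Implicit Types (g : R -> R) (t : R).

Lemma exp2_coefE n (x : R) : exp2_coef n * x ^+ n = exp_coeff (2 * x) n.
Proof. by rewrite /exp2_coef exp_coeffE exprMn; ring. Qed.

Lemma series_le_expR n (x : R) : 0 <= x -> series (exp_coeff x) n <= expR x.
Proof.
move=> x0; apply: nondecreasing_cvgn_le; last exact: is_cvg_series_exp_coeff.
by apply: nondecreasing_series => k _ _; exact: exp_coeff_ge0.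
Qed.

(** The Taylor remainder is a sum of terms z^k / k!, each nondecreasing for z >= 0. *)
Lemma expR_tail_homo n (x y : R) : 0 <= x -> x <= y ->
  expR x - series (exp_coeff x) n <= expR y - series (exp_coeff y) n.
Proof.
move=> x0 xy; have y0 : 0 <= y by exact: le_trans xy.
have tail (z : R) : (series (exp_coeff z) m - series (exp_coeff z) n) @[m --> \oo] -->
    expR z - series (exp_coeff z) n.
  by apply: cvgB; [exact: is_cvg_series_exp_coeff|exact: cvg_cst].
rewrite -(cvg_lim _ (tail x))// -(cvg_lim _ (tail y))//; apply: ler_lim.
- by apply/cvg_ex; eexists; exact: tail.
- by apply/cvg_ex; eexists; exact: tail.
exists n => // m /= nm; rewrite !sub_series_geq//; apply: ler_sum => k _.
by rewrite !exp_coeffE ler_wpM2l ?invr_ge0// lerXn2r.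
Qed.

(** Termwise integration is justified by uniform convergence: on [0, t] the Taylor remainder is at
    most its value at the right end ([expR_tail_homo]). *)
Lemma cvg_primitive_exp2 g t : continuous g -> 0 <= t ->
  series (fun m => primitive (fun x => exp2_coef m * x ^+ m * g x) t) @ \oo -->
  primitive (fun x => expR (2 * x) * g x) t.
Proof.
move=> cg t0.
pose P (n : nat) (x : R) := series (exp_coeff (2 * x)) n.
have cX (k : nat) : continuous (fun x : R => x ^+ k).
  by move=> x; exact: exprn_continuous.
have cM (h1 h2 : R -> R) : continuous h1 -> continuous h2 ->
    continuous (fun x => h1 x * h2 x).
  by move=> c1 c2 x; apply: cvgM; [exact: c1|exact: c2].
have c2 : continuous (fun x : R => 2 * x).
  by apply: cM => x; [exact: cst_continuous|exact: cvg_id].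
have cE : continuous (fun x : R => expR (2 * x)).
  by move=> x; apply: (continuous_comp (c2 x)); exact: continuous_expR.
have cterm (k : nat) : continuous (fun x : R => exp2_coef k * x ^+ k * g x).
  apply: (cM _ _ _ cg); apply: (cM _ _ _ (cX k)) => x; exact: cst_continuous.
have cP n : continuous (P n).
  have -> : P n = fun x => \sum_(0 <= k < n) exp2_coef k * x ^+ k.
    by apply/funext => x; rewrite /P /series; apply: eq_bigr => k _; rewrite exp2_coefE.
  by apply: continuous_sum => k; apply: (cM _ _ _ (cX k)) => x; exact: cst_continuous.
have SE n : series (fun m => primitive (fun x => exp2_coef m * x ^+ m * g x) t) n =
    primitive (fun x => P n x * g x) t.
  rewrite /series /=.
  have -> : (fun x => P n x * g x) =
      fun x => \sum_(0 <= k < n) 1 * (exp2_coef k * x ^+ k * g x).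
    apply/funext => x; rewrite /P /series /= mulr_suml; apply: eq_bigr => k _.
    by rewrite exp2_coefE mul1r.
  by rewrite primitive_sum//; apply: eq_bigr => k _; rewrite mul1r.
pose M := primitive (fun x => `|g x|) t.
have cng : continuous (fun x => `|g x|).
  by move=> x; apply: (continuous_comp (cg x)); exact: norm_continuous.
have bnd n : `|primitive (fun x => expR (2 * x) * g x) t -
    primitive (fun x => P n x * g x) t| <= (expR (2 * t) - P n t) * M.
  pose D (x : R) := (expR (2 * x) - P n x) * g x.
  have cD : continuous D.
    by apply: (cM _ _ _ cg) => x; apply: cvgB; [exact: cE|exact: cP].
  have -> : primitive (fun x => expR (2 * x) * g x) t -
      primitive (fun x => P n x * g x) t = primitive D t.
    apply/eqP; rewrite subr_eq; apply/eqP.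
    rewrite -(primitiveD _ _ _ cD (cM _ _ (cP n) cg)).
    by apply: eq_primitive => x _; rewrite /D; ring.
  have cnD : continuous (fun x => `|D x|).
    by move=> x; apply: (continuous_comp (cD x)); exact: norm_continuous.
  apply: (le_trans (le_normr_Rintegral _ _)) => //.
    exact: continuous_integrable_itv.
  rewrite /M -primitiveZ// /primitive; apply: le_Rintegral => //.
  - exact: continuous_integrable_itv.
  - by apply: continuous_integrable_itv; apply: cM => // x; exact: cst_continuous.
  move=> x; rewrite /= in_itv /= => /andP[x0 xt]; rewrite normrM.
  apply: ler_wpM2r => //; rewrite ger0_norm.
    by apply: expR_tail_homo; rewrite ?mulr_ge0// ler_wpM2l.
  by rewrite subr_ge0 series_le_expR// mulr_ge0.
have b0 : (expR (2 * t) - P n t) * M @[n --> \oo] --> 0.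
  rewrite -[X in _ --> X](mul0r M); apply: cvgM; last exact: cvg_cst.
  rewrite -(subrr (expR (2 * t))); apply: cvgB; first exact: cvg_cst.
  exact: is_cvg_series_exp_coeff.
apply/cvgrPdist_le => e e0; move/cvgrPdist_le : b0 => /(_ _ e0); apply: filterS => n.
rewrite sub0r normrN SE => be; apply: (le_trans (bnd n)).
exact: (le_trans (ler_norm _)).
Qed.

Lemma cvg_divexp t : 0 < t ->
  series (fun k => divexp_coef k * t ^+ k) @ \oo --> (expR (2 * t) - 1) / (2 * t).
Proof.
move=> t0; have t2 : 2 * t != 0 by rewrite lt0r_neq0// mulr_gt0.
(* Off by one: [n] terms of E are [n.+1] terms of the exponential, without the constant one, divided
   by 2 t. *)
have -> : series (fun k => divexp_coef k * t ^+ k) =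
    fun n => (series (exp_coeff (2 * t)) n.+1 - 1) / (2 * t).
  apply/funext => n; apply: (mulIf t2); rewrite divfK// /series /= mulr_suml.
  rewrite big_nat_recl// exp_coeffE expr0 fact0 invr1 mulr1 addrAC subrr add0r.
  by apply: eq_bigr => k _; rewrite /divexp_coef !exprMn !exprS; ring.
apply: cvgM; last exact: cvg_cst.
apply: cvgB; last exact: cvg_cst.
by rewrite (cvg_shiftS (series (exp_coeff (2 * t)))); exact: is_cvg_series_exp_coeff.
Qed.

(** The terms of E(t) are nonnegative, so Mertens' theorem applies with the merely convergent series
    of the sigma_m(t). By [conv_divexp_magnus] the same Cauchy product also has the limit found in
    [cvg_primitive_exp2]. *)
Lemma magnus_coord_sum g t : continuous g -> 0 < t ->
  cvgn (series (magnus_coord g ^~ t)) ->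
  (expR (2 * t) - 1) / (2 * t) * limn (series (magnus_coord g ^~ t)) =
  primitive (fun x => expR (2 * x) * g x) t.
Proof.
move=> cg t0 cs; have ce := cvg_divexp _ t0.
have u0 k : 0 <= divexp_coef k * t ^+ k :> R.
  by rewrite mulr_ge0 ?exprn_ge0 ?(ltW t0)// /divexp_coef divr_ge0// exprn_ge0.
have := cvg_series_conv _ _ u0 (cvgP _ ce) cs.
rewrite (cvg_lim _ ce)// => h.
have := cvg_primitive_exp2 _ _ cg (ltW t0).
have -> : (fun m => primitive (fun x => exp2_coef m * x ^+ m * g x) t) =
    conv (fun k => divexp_coef k * t ^+ k) (magnus_coord g ^~ t).
  by apply/funext => m; rewrite conv_divexp_magnus// ltW.
by move=> h'; apply: cvg_unique h h'.
Qed.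

End exponential_weight.

(** * Functions of class C1 on the half-line *)

Section halfline.
Context {R : realType}.
Implicit Types (f df : R -> R) (t : R).

Lemma C1_halfline_near f df (x e : R) : C1_halfline f df -> 0 <= x -> 0 < e ->
  \forall y \near x, 0 <= y -> y != x ->
    `|df x - (f y - f x) / (y - x)| <= e.
Proof.
move=> [dfE _] x0 e0; have /cvgrPdist_le /(_ _ e0) := dfE x x0.
move=> h.
have {}h : \forall y \near x, y != x -> `[0, +oo[%classic y ->
    `|df x - (f y - f x) / (y - x)| <= e by exact: h.
apply: filterS h => y h y0 yx.
by apply: h => //; rewrite /= in_itv /= andbT.
Qed.

(** Near [x] the difference quotients are bounded by [|df x| + 1], which gives a Lipschitz estimate
    at [x]. *)
Lemma C1_halfline_continuous f df : C1_halfline f df ->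
  {within `[0, +oo[, continuous f}.
Proof.
move=> C1; apply/subspace_continuousP => x; rewrite /= in_itv /= andbT => x0.
pose L := `|df x| + 1; have L0 : 0 < L by rewrite ltr_wpDl.
apply/cvgrPdist_le => e e0; have eL : 0 < e / L by rewrite divr_gt0.
suff : \forall y \near x, `[0, +oo[%classic y -> `|f x - f y| <= e by exact.
near=> y; rewrite /= in_itv /= andbT => y0.
have [->|yx] := eqVneq y x; first by rewrite subrr normr0 ltW.
have q1 : `|df x - (f y - f x) / (y - x)| <= 1.
  by move: y0 yx; near: y; exact: C1_halfline_near.
have q : `|(f y - f x) / (y - x)| <= L.
  rewrite -(subrK (df x) (_ / _)) (le_trans (ler_normD _ _))// addrC lerD//.
  by rewrite distrC.
have yx0 : y - x != 0 by rewrite subr_eq0.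
have xyL : `|y - x| <= e / L.
  rewrite distrC; near: y; apply/nbhs_ballP; exists (e / L) => // z /=.
  exact: ltW.
rewrite distrC -(divfK yx0 (f y - f x)) normrM.
by rewrite -(divfK (lt0r_neq0 L0) e) mulrC ler_pM.
Unshelve. all: by end_near. Qed.

(** Precomposition with [Num.max 0] freezes the function at its value at 0 on the left, turning
    one-sided continuity at 0 into two-sided continuity. *)
Lemma continuous_extension f :
  {within `[0, +oo[, continuous f} -> continuous (fun x : R => f (Num.max 0 x) : R).
Proof.
move=> /subspace_continuousP cf x.
have m0 (y : R) : `[0, +oo[%classic (Num.max 0 y) by rewrite /= in_itv /= andbT le_max lexx.
apply: (cvg_comp _ _ _ (cf _ (m0 x))).
have cm : {for x, continuous (fun y : R => Num.max 0 y)}.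
  by apply: continuous_max; [exact: cst_continuous|exact: cvg_id].
move=> A wA; suff : \forall y \near x, A (Num.max 0 y) by [].
have h : \forall y \near x, `[0, +oo[%classic (Num.max 0 y : R) ->
    A (Num.max 0 y) := cm _ wA.
by apply: filterS h => y; apply; exact: m0.
Qed.

Lemma C1_halfline_is_derive f df t : C1_halfline f df -> 0 < t ->
  is_derive t 1 (fun x : R => f (Num.max 0 x) : R) (df t).
Proof.
move=> C1 t0; apply/is_derive1_caratheodory.
exists (fun z => if z == t then df t else
  (f (Num.max 0 z) - f (Num.max 0 t)) / (z - t)).
split; [|rewrite /prop_for /continuous_at eqxx|by rewrite eqxx].
  move=> z; case: eqP => [->|/eqP zt]; first by rewrite !subrr mulr0.
  by rewrite divfK// subr_eq0.
apply/cvgrPdist_lt => e e0; have e2 : 0 < e / 2 by rewrite divr_gt0.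
have e2e : e / 2 < e by rewrite ltr_pdivrMr// mulr_natr mulr2n ltrDl.
near=> z; case: eqP => [_|/eqP zt]; first by rewrite subrr normr0.
have z0 : 0 <= z by apply: ltW; near: z; exact: lt_nbhsr.
rewrite !max_r ?(ltW t0)//; apply: (le_lt_trans _ e2e).
by move: z0 zt; near: z; exact: C1_halfline_near (ltW t0) e2.
Unshelve. all: by end_near. Qed.

End halfline.

(** * Closed form of [Theta] *)

Section theta.
Context {R : realType}.
Implicit Types (x y t : R).

Lemma expR2_gt1 x : 0 < x -> 1 < expR (2 * x).
Proof. by move=> x0; rewrite expR_gt1 mulr_gt0. Qed.

Lemma expRN2_lt1 x : 0 < x -> expR (- 2 * x) < 1.
Proof. by move=> x0; rewrite expR_lt1 mulNr oppr_lt0 mulr_gt0. Qed.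

(** The strict inequality 1 + z < exp z at z = - 2 x. *)
Lemma theta_den_lt0 x : 0 < x -> 1 - 2 * x - expR (- 2 * x) < 0.
Proof.
move=> x0; rewrite subr_lt0 -mulNr; apply: expR_gt1Dx.
by rewrite mulf_neq0// ?oppr_eq0 ?pnatr_eq0// gt_eqF.
Qed.

Definition theta_rate x : R := (1 - x - (1 + x) * expR (- 2 * x)) /
  ((1 - expR (- 2 * x)) * (1 - 2 * x - expR (- 2 * x))).

(** A primitive of [4 * theta_rate] on the positive axis; the sign in the last logarithm makes its
    argument positive. *)
Definition theta_log x : R :=
  ln (expR (2 * x) - 1) + ln (1 - expR (- 2 * x)) -
  ln (- (1 - 2 * x - expR (- 2 * x))).

Lemma is_derive_theta_log x : 0 < x ->
  is_derive x 1 (theta_log : R -> R) (4 * theta_rate x).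
Proof.
rewrite /theta_rate.
move=> x0; have h1 := expR2_gt1 x x0; have h2 := expRN2_lt1 x x0.
have h3 := theta_den_lt0 x x0.
have dE (c : R) : is_derive x 1 (fun y : R => expR (c * y) : R) (expR (c * x) * c).
  have dl : is_derive x 1 (fun y : R => c * y : R) c.
    by apply: is_derive_eq; rewrite /GRing.scale /= mulr1.
  exact: (@is_derive1_comp _ expR (fun y : R => c * y : R) x _ _ _ dl).
have d1 : is_derive x 1 (fun y : R => expR (2 * y) - 1 : R) (expR (2 * x) * 2).
  by have ? := dE 2; apply: is_derive_eq; rewrite subr0.
have d2 : is_derive x 1 (fun y : R => 1 - expR (- 2 * y) : R) (2 * expR (- 2 * x)).
  have ? := dE (- 2); apply: is_derive_eq; ring.
have d3 : is_derive x 1 (fun y : R => - (1 - 2 * y - expR (- 2 * y)) : R)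
    (2 * (1 - expR (- 2 * x))).
  have ? := dE (- 2); apply: is_derive_eq; rewrite /GRing.scale /=; ring.
have p1 : 0 < expR (2 * x) - 1 by rewrite subr_gt0.
have p2 : 0 < 1 - expR (- 2 * x) by rewrite subr_gt0.
have p3 : 0 < - (1 - 2 * x - expR (- 2 * x)) by rewrite oppr_gt0.
have e1 := @is_derive1_comp _ (@ln R)
    (fun y : R => expR (2 * y) - 1 : R) x _ _ (is_derive1_ln p1) d1.
have e2 := @is_derive1_comp _ (@ln R)
    (fun y : R => 1 - expR (- 2 * y) : R) x _ _ (is_derive1_ln p2) d2.
have e3 := @is_derive1_comp _ (@ln R)
    (fun y : R => - (1 - 2 * y - expR (- 2 * y)) : R) x _ _ (is_derive1_ln p3) d3.
have := is_deriveB (is_deriveD e1 e2) e3 => d.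
apply: (is_derive_eq d).
have e0 := expR_gt0 (2 * x).
have eN : expR (- 2 * x) = (expR (2 * x))^-1 by rewrite mulNr expRN.
move: p1 p2 p3; rewrite eN => p1 p2 p3.
(* Once exp (-2 x) is written as the inverse of exp (2 x), this is the third denominator with
   fractions cleared, which [field] requires to be nonzero. *)
have p4 : (1 - 2 * x) * expR (2 * x) - 1 < 0.
  have -> : (1 - 2 * x) * expR (2 * x) - 1 =
      - (expR (2 * x) * - (1 - 2 * x - (expR (2 * x))^-1)).
    by field; rewrite lt0r_neq0.
  by rewrite oppr_lt0 mulr_gt0.
by field; rewrite (lt0r_neq0 p1) (lt0r_neq0 e0) (ltr0_neq0 p4).
Qed.

Lemma continuous_theta_rate x t : 0 < x ->
  {within `[x, t], continuous theta_rate}.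
Proof.
move=> x0; apply: continuous_in_subspaceT => y; rewrite inE /= in_itv /=.
move=> /andP[xy _]; have y0 := lt_le_trans x0 xy.
have cm (c : R) : {for y, continuous (fun z : R => c * z)}.
  by apply: cvgM; [exact: cvg_cst|exact: cvg_id].
have ce : {for y, continuous (fun z : R => expR (- 2 * z))}.
  by apply: (continuous_comp (cm (- 2))); exact: continuous_expR.
have c1 : {for y, continuous (fun z : R => 1 - expR (- 2 * z))}.
  by apply: cvgB; [exact: cvg_cst|exact: ce].
have c2 : {for y, continuous (fun z : R => 1 - 2 * z - expR (- 2 * z))}.
  by apply: cvgB; [apply: cvgB; [exact: cvg_cst|exact: cm]|exact: ce].
have c3 : {for y, continuous (fun z : R => 1 - z - (1 + z) * expR (- 2 * z))}.
  apply: cvgB; [apply: cvgB; [exact: cvg_cst|exact: cvg_id]|].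
  by apply: cvgM; [apply: cvgD; [exact: cvg_cst|exact: cvg_id]|exact: ce].
apply: cvgM; first exact: c3.
apply: cvgV; last by apply: cvgM; [exact: c1|exact: c2].
rewrite mulf_neq0//; last by rewrite lt_eqF// theta_den_lt0.
by rewrite gt_eqF// subr_gt0 expRN2_lt1.
Qed.

Lemma expR_theta_integral x t : 0 < x -> x <= t ->
  expR (- 4 * \int[lebesgue_measure]_(y in `[x, t]) theta_rate y) =
  expR (theta_log x - theta_log t).
Proof.
move=> x0; rewrite le_eqVlt => /predU1P[<-|xt].
  by rewrite set_itv1 Rintegral_set1 mulr0 subrr.
have cq := continuous_theta_rate x t x0.
have c4 : {within `[x, t], continuous (fun y => 4 * theta_rate y)}.
  by move=> y; apply: cvgM; [exact: cvg_cst|exact: cq].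
congr expR; rewrite mulNr -RintegralZl//; last first.
  by apply: continuous_compact_integrable => //; exact: segment_compact.
have dl y : y \in `[x, t] -> is_derive y 1 (theta_log : R -> R) (4 * theta_rate y).
  rewrite in_itv /= => /andP[xy _]; apply: is_derive_theta_log.
  exact: lt_le_trans xy.
have cl y : y \in `[x, t] -> {for y, continuous theta_log}.
  move=> /dl dy; apply/differentiable_continuous/derivable1_diffP.
  exact: (@ex_derive _ _ _ _ _ _ _ dy).
rewrite /Rintegral (continuous_FTC2 xt c4 _ _ (F := theta_log)).
- by rewrite -EFinB /= opprB.
- split.
  + move=> y /subset_itv_oo_cc /dl dy; exact: (@ex_derive _ _ _ _ _ _ _ dy).
  + by apply: cvg_at_right_filter; apply: cl; rewrite in_itv /= lexx ltW.
  + by apply: cvg_at_left_filter; apply: cl; rewrite in_itv /= lexx ltW.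
- move=> y /subset_itv_oo_cc /dl dy.
  by rewrite derive1E (@derive_val _ _ _ _ _ _ _ dy).
Qed.

Lemma expR_theta_log x : 0 < x -> expR (theta_log x) =
  (expR (2 * x) - 1) * (1 - expR (- 2 * x)) / - (1 - 2 * x - expR (- 2 * x)).
Proof.
move=> x0; rewrite /theta_log expRD expRN expRD !lnK//.
- by rewrite posrE oppr_gt0 theta_den_lt0.
- by rewrite posrE subr_gt0 expRN2_lt1.
- by rewrite posrE subr_gt0 expR2_gt1.
Qed.

(** The exponential of [theta_log x] cancels the last factor of [Theta] up to sign and
    [expR (2 * x) - 1], so x Theta(t, x) separates into a factor in [t] and one in [x]. At [x = 0]
    both sides are 0, whatever the value of [Theta] there. *)
Lemma ThetaE x t : 0 <= x -> 0 < t -> x <= t ->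
  x * Theta t x = (1 - 2 * t - expR (- 2 * t)) /
    ((expR (2 * t) - 1) * (1 - expR (- 2 * t))) * (1 - expR (2 * x)).
Proof.
rewrite le_eqVlt => /predU1P[<- _ _|x0 t0 xt].
  by rewrite mul0r mulr0 expR0 subrr mulr0.
have -> : Theta t x = - expR (- 4 *
    \int[lebesgue_measure]_(y in `[x, t]) theta_rate y) *
    ((1 - 2 * x - expR (- 2 * x)) / (x * (1 - expR (- 2 * x)))) by [].
rewrite expR_theta_integral// expRD expRN !expR_theta_log//.
have tx := theta_den_lt0 x x0; have tt := theta_den_lt0 t t0.
have h1x := expR2_gt1 x x0; have h1t := expR2_gt1 t t0.
have h2x := expRN2_lt1 x x0; have h2t := expRN2_lt1 t t0.
set Dx := 1 - 2 * x - _ in tx *; set Dt := 1 - 2 * t - _ in tt *.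
move: h1x h1t h2x h2t; rewrite -subr_gt0 -(subr_gt0 _ (expR (2 * t))).
rewrite -(subr_gt0 _ 1) -(subr_gt0 (expR (- 2 * t)) 1).
set ex := expR (2 * x) - 1; set et := expR (2 * t) - 1.
set ux := 1 - expR (- 2 * x); set ut := 1 - expR (- 2 * t).
have -> : 1 - expR (2 * x) = - ex by rewrite /ex opprB.
move=> pex pet pux put; field.
by rewrite (ltr0_neq0 tx) (ltr0_neq0 tt) !lt0r_neq0.
Qed.

End theta.

(** * Integration by parts and the formula for [sigma] *)

Section sigma_formula.
Context {R : realType}.
Implicit Types (f df : R -> R) (t : R).

(** The primitive [expR (2 * x) - 1] of [2 * expR (2 * x)] vanishes at 0, which removes the boundary
    term there; up to sign it is also the [x]-factor in [ThetaE]. *)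
Lemma primitive_expR_by_parts f df t : C1_halfline f df -> 0 <= t ->
  2 * primitive (fun x => expR (2 * x) * f (Num.max 0 x)) t =
  (expR (2 * t) - 1) * f t -
  primitive (fun x => (expR (2 * x) - 1) * df (Num.max 0 x)) t.
Proof.
move=> C1 t0.
have cg : continuous (fun x : R => f (Num.max 0 x) : R).
  exact/continuous_extension/C1_halfline_continuous/C1.
have cdg : continuous (fun x : R => df (Num.max 0 x) : R).
  by apply: continuous_extension; case: C1.
have cM (h1 h2 : R -> R) : continuous h1 -> continuous h2 ->
    continuous (fun x => h1 x * h2 x).
  by move=> c1 c2 x; apply: cvgM; [exact: c1|exact: c2].
have cE : continuous (fun x : R => expR (2 * x) : R).
  have c2 : continuous (fun x : R => 2 * x).
    by apply: cM => x; [exact: cst_continuous|exact: cvg_id].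
  by move=> x; apply: (continuous_comp (c2 x)); exact: continuous_expR.
have cE1 : continuous (fun x : R => expR (2 * x) - 1 : R).
  by move=> x; apply: cvgB; [exact: cE|exact: cvg_cst].
have c1 : continuous (fun x : R => 2 * (expR (2 * x) * f (Num.max 0 x)) : R).
  by apply: (cM _ _ _ (cM _ _ cE cg)) => x; exact: cst_continuous.
have c2 := cM _ _ cE1 cdg.
apply/eqP; rewrite eq_sym subr_eq -primitiveZ//; last exact: cM.
rewrite -primitiveD//; apply/eqP/esym.
have <- : (expR (2 * t) - 1) * f (Num.max 0 t) = (expR (2 * t) - 1) * f t.
  by rewrite max_r.
apply: (primitive_unique (fun x : R => (expR (2 * x) - 1) * f (Num.max 0 x))).
- exact: t0.
- by move=> x; apply: cvgD; [exact: c1|exact: c2].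
- exact: cM.
- by rewrite mulr0 expR0 subrr mul0r.
move=> x x0; have d1 := C1_halfline_is_derive f df x C1 x0.
have dl : is_derive x 1 (fun y : R => 2 * y : R) 2.
  by apply: is_derive_eq; rewrite /GRing.scale /= mulr1.
have dE : is_derive x 1 (fun y : R => expR (2 * y) : R) (expR (2 * x) * 2).
  exact: (@is_derive1_comp _ expR (fun y : R => 2 * y : R) x _ _ _ dl).
have dE1 : is_derive x 1 (fun y : R => expR (2 * y) - 1 : R) (expR (2 * x) * 2).
  by apply: is_derive_eq; rewrite subr0.
apply: (is_derive_eq (is_deriveM dE1 d1)).
by rewrite /GRing.scale /= max_r ?(ltW x0)//; ring.
Qed.

Lemma sigmaE f df t : C1_halfline f df -> 0 < t ->
  (expR (2 * t) - 1) / (2 * t) * sigma f df t =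
  primitive (fun x => expR (2 * x) * f (Num.max 0 x)) t.
Proof.
move=> C1 t0; have := primitive_expR_by_parts f df t C1 (ltW t0).
set I := primitive _ _; set J := primitive _ _ => IJ.
have -> : I = ((expR (2 * t) - 1) * f t - J) / 2 by rewrite -IJ mulrC mulKf.
(* The factor of [ThetaE] that depends on [t] alone; the integral in [sigma] is then [- c * J]. *)
pose c := (1 - 2 * t - expR (- 2 * t)) /
    ((expR (2 * t) - 1) * (1 - expR (- 2 * t))).
have cE : continuous (fun x : R => (expR (2 * x) - 1) * df (Num.max 0 x) : R).
  have cdg : continuous (fun x : R => df (Num.max 0 x) : R).
    by apply: continuous_extension; case: C1.
  move=> x; apply: cvgM; last exact: cdg.
  apply: cvgB; last exact: cvg_cst.
  apply: (@continuous_comp _ _ _ (fun z : R => 2 * z) expR); last exact: continuous_expR.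
  by apply: cvgM; [exact: cvg_cst|exact: cvg_id].
have -> : sigma f df t = t * f t + t * (1 - expR (- 2 * t)) /
    (1 - 2 * t - expR (- 2 * t)) * (- c * J).
  rewrite /sigma; congr (_ + _ * _); rewrite /J -primitiveZ//.
  apply: eq_Rintegral => x; rewrite inE /= in_itv /= => /andP[x0 xt].
  by rewrite mulrAC ThetaE// max_r// /c; ring.
have tt := theta_den_lt0 t t0; have h1t := expR2_gt1 t t0.
have h2t := expRN2_lt1 t t0.
rewrite /c; field.
by rewrite (lt0r_neq0 t0) (ltr0_neq0 tt) !lt0r_neq0 ?subr_gt0.
Qed.

End sigma_formula.

(** * Assembly of the expansion *)

(** This is where [N >= 1] enters: for [N = 0] the matrix [A1] is 0 and convergence of the matrix
    series would say nothing about the sigma_m(t). *)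
Lemma A1_00_neq0 (R : realType) (N : nat) : (0 < N)%N -> A1 R N ord0 ord0 != 0.
Proof. by move=> N0; rewrite mxE eqxx mulr0 subr0 pnatr_eq0 -lt0n. Qed.

Theorem mainTheorem2 (R : realType) (N : nat) (hN : (1 <= N)%N)
    (f df : R -> R) (hf : C1_halfline f df)
    (t : R) (ht : 0 < t) (hcvg : magnus_converges (generator N f) t) :
  magnus_expansion (generator N f) t = t *: A0 R N + sigma f df t *: A1 R N.
Proof.
pose g (x : R) : R := f (Num.max 0 x).
have fg x : 0 <= x -> f x = g x by move=> x0; rewrite /g max_r.
have cg : continuous g by exact/continuous_extension/C1_halfline_continuous/hf.
pose s := series (magnus_coord g ^~ t).
(* The index is [n.+1] because the empty partial sum lacks [t *: A0], which order 0 alone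
   contributes. *)
have termE n : series (magnus_term (generator N f) t) n.+1 =
    t *: A0 R N + s n.+1 *: A1 R N.
  rewrite /s /series /= (eq_bigr _ (fun m _ => magnus_term_span f g m t fg cg (ltW ht))).
  rewrite big_split /= -!scaler_suml; congr (_ *: _ + _).
  by rewrite big_nat_recl// big1 ?addr0 ?scale1r.
(* Convergence passes from the matrices to [s] through the (0, 0) entry, where [A1] is nonzero. *)
have cs : cvgn s.
  have entry (a b : R) : (a *: A0 R N + b *: A1 R N) ord0 ord0 =
      a * A0 R N ord0 ord0 + b * A1 R N ord0 ord0.
    by rewrite [LHS]mxE [X in X + _]mxE [X in _ + X]mxE.
  have a1 := A1_00_neq0 R N hN; apply/cvg_ex.
  exists ((magnus_expansion (generator N f) t ord0 ord0 - t * A0 R N ord0 ord0) /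
    A1 R N ord0 ord0).
  rewrite -cvg_shiftS /=.
  have -> : (fun n => s n.+1) = (fun n =>
      (series (magnus_term (generator N f) t) n.+1 ord0 ord0 - t * A0 R N ord0 ord0) /
      A1 R N ord0 ord0).
    by apply/funext => n; rewrite termE entry addrAC subrr add0r mulfK.
  apply: cvgM; last exact: cvg_cst.
  apply: cvgB; last exact: cvg_cst.
  rewrite (cvg_shiftS (fun n => series (magnus_term (generator N f) t) n ord0 ord0)).
  have ce : {for magnus_expansion (generator N f) t,
      continuous (fun M : 'M[R]_N.+1 => M ord0 ord0)}.
    exact: coord_continuous.
  exact: (continuous_cvg _ ce hcvg).
(* Both sides have the same product with E(t), which is positive. *)
have sE : limn s = sigma f df t.
  have k0 : (expR (2 * t) - 1) / (2 * t) != 0.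
    by rewrite lt0r_neq0// divr_gt0 ?mulr_gt0// subr_gt0 expR2_gt1.
  by apply: (mulfI k0); rewrite sigmaE// magnus_coord_sum.
rewrite -sE; apply: cvg_lim => //.
rewrite -cvg_shiftS /=.
have -> : (fun n => series (magnus_term (generator N f) t) n.+1) =
    fun n => t *: A0 R N + s n.+1 *: A1 R N by apply/funext.
apply: cvgD; first exact: cvg_cst.
apply: cvgZr_tmp; rewrite (cvg_shiftS s); exact: cs.
Qed.
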